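(* Let $n, k$ be non-negative integers and let $G$ be a finite simple graph. If for every edge $e \in E(G)$ the graph $G - V(e)$ is $(n,k)$-extendable, then $G$ is $(n,k+1)$-extendable. Moreover, this hypothesis does not in general imply that $G$ is $(n,k+2)$-extendable, nor that $G$ is $(n+2,k)$-extendable (i.e., there exist graphs $G$ such that $G - V(e)$ is $(n,k)$-extendable for every $e\in E(G)$ but $G$ is not $(n,k+2)$-extendable, and there exist graphs $G$ such that $G-V(e)$ is $(n,k)$-extendable for every $e \in E(G)$ but $G$ is not $(n+2,k)$-extendable).
   Context: A $k$-matching is a matching with $k$ edges; a 1-factor is a perfect matching. For $S \subseteq V(G)$, $G - S$ is the subgraph induced on $V(G)\setminus S$; for an edge $e$, $V(e)$ is its set of endpoints. For non-negative integers $n,k$, a graph $H$ is $(n,k)$-extendable if $n + 2k \leq |V(H)| - 2$, $|V(H)| - n$ is even, and for every set $S$ of $n$ vertices of $H$, the graph $H - S$ contains a $k$-matching and every $k$-matching of $H - S$ can be extended to a 1-factor of $H - S$.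
   Formalization: The graph G is additionally required to have at least one edge: for an edgeless G the hypothesis is vacuous while (n,k+1)-extendability fails (no (k+1)-matching exists); the counterexample graphs in the ''moreover'' part also have an edge. *)

(* Defs.v *)
From mathcomp Require Import all_boot.

Set Implicit Arguments.
Unset Strict Implicit.
Unset Printing Implicit Defensive.

Record sgraph := SGraph {
  svertex :> finType;
  sedge : rel svertex;
  sedge_sym : symmetric sedge;
  sedge_irrefl : irreflexive sedge }.

(* An edge is identified with its two-element set of endpoints, so an edge [e]
   also serves as the vertex set V(e). *)
Definition edges (G : sgraph) : {set {set G}} :=
  [set [set p.1; p.2] | p in [pred p : G * G | sedge p.1 p.2]].

Section Induced.
Variables (G : sgraph) (A : {set G}).

Definition induced_rel : rel {x : G | x \in A} :=
  [rel x y | sedge (val x) (val y)].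

Lemma induced_sym : symmetric induced_rel.
Proof. by move=> x y; rewrite /induced_rel /= sedge_sym. Qed.

Lemma induced_irrefl : irreflexive induced_rel.
Proof. by move=> x; rewrite /induced_rel /= sedge_irrefl. Qed.

Definition induced : sgraph := SGraph induced_sym induced_irrefl.
End Induced.

Definition delete (G : sgraph) (S : {set G}) : sgraph := induced (~: S).

Definition is_matching (G : sgraph) (M : {set {set G}}) : bool :=
  (M \subset edges G) && trivIset M.

Definition is_kmatching (G : sgraph) (k : nat) (M : {set {set G}}) : bool :=
  is_matching M && (#|M| == k).

Definition is_1factor (G : sgraph) (F : {set {set G}}) : bool :=
  is_matching F && (cover F == [set: G]).

(* The size condition n + 2k <= |V(H)| - 2 is an inequality between integers;
   it is written additively to avoid truncated subtraction.  It also makes the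
   subtraction in the parity condition exact. *)
Definition extendable (n k : nat) (H : sgraph) : Prop :=
  [/\ n + 2 * k + 2 <= #|H|,
      ~~ odd (#|H| - n)
    & forall S : {set H}, #|S| = n ->
        (exists M : {set {set delete S}}, is_kmatching k M) /\
        (forall M : {set {set delete S}}, is_kmatching k M ->
           exists F : {set {set delete S}}, is_1factor F /\ M \subset F)].

(* Main.v *)
Require Import Defs.
From mathcomp Require Import all_boot.
From mathcomp Require Import zify.

(* For the implication, a (k+1)-matching M of G - T is handled by picking e in M
   and extending M - e in G - V(e) - T.

   Both non-implications are witnessed by one graph: an independent set of
   n + k + 2 "rim" vertices and a large "core" clique, completely joined to each
   other, and an "apex" whose neighbours are exactly the rim vertices.  Deleting
   n vertices and a (k+1)-matching destroys at most n + k + 1 rim vertices, since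
   an edge meets the rim at most once, so the apex can still be matched to the
   rim and the dominating core absorbs all other vertices.  Deleting n + 2
   vertices and a k-matching, or n vertices and a (k+2)-matching, can destroy the
   whole rim, which isolates the apex. *)

Set Implicit Arguments.
Unset Strict Implicit.
Unset Printing Implicit Defensive.

(** * Finite sets and their images *)

Lemma exists_subset_card (T : finType) (A : {set T}) m :
  m <= #|A| -> exists2 B : {set T}, B \subset A & #|B| = m.
Proof.
case/card_geqP=> s [s_uniq s_size sA]; exists [set x in s].
  by apply/subsetP=> x; rewrite inE; apply: sA.
by rewrite cardsE (card_uniqP s_uniq).
Qed.

Lemma preimsetK (aT rT : finType) (f : aT -> rT) (B : {set rT}) :
  B \subset f @: [set: aT] -> f @: (f @^-1: B) = B.
Proof.
move=> sB; apply/setP=> y; apply/imsetP/idP => [[x]|yB]; first by rewrite inE => ? ->.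
have /imsetP[x _ yx] := subsetP sB y yB.
by exists x; rewrite ?inE -?yx.
Qed.

Lemma imsetC_inj (aT rT : finType) (f : aT -> rT) (A : {set aT}) :
  injective f -> f @: (~: A) = f @: [set: aT] :\: f @: A.
Proof.
move=> f_inj; apply/setP=> y; apply/imsetP/setDP => [[x xA ->]|[/imsetP[x _ ->]]].
  by rewrite !mem_imset // inE -in_setC.
by rewrite mem_imset // => xA; exists x; rewrite ?inE.
Qed.

(** * Matchings of a fixed graph and the vertices they cover *)

Section Matchings.
Variable G : sgraph.
Implicit Types (M N F : {set {set G}}) (A W X T : {set G}) (e : {set G}).

Lemma edgesP e :
  reflect (exists x y : G, sedge x y /\ e = [set x; y]) (e \in edges G).
Proof.
apply: (iffP imsetP) => [[[x y] /= xy ->]|[x [y [xy ->]]]]; first by exists x, y.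
by exists (x, y).
Qed.

Lemma card_edge e : e \in edges G -> #|e| = 2.
Proof.
case/edgesP=> x [y [xy ->]]; rewrite cards2; case: eqP xy => // ->.
by rewrite sedge_irrefl.
Qed.

Lemma is_matchingS M N : M \subset N -> is_matching N -> is_matching M.
Proof.
move=> sMN /andP[NE triv]; apply/andP; split; first exact: subset_trans NE.
exact: trivIsetS sMN triv.
Qed.

Lemma is_matchingU M N :
  is_matching M -> is_matching N -> [disjoint cover M & cover N] ->
  is_matching (M :|: N).
Proof.
move=> /andP[ME Mtriv] /andP[NE Ntriv] dMN; apply/andP; split.
  by rewrite subUset ME.
exact: trivIsetU.
Qed.

Lemma cover_setU M N : cover (M :|: N) = cover M :|: cover N.
Proof. by rewrite /cover bigcup_setU. Qed.

Lemma is_matching1 e : e \in edges G -> is_matching [set e].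
Proof. by move=> eG; rewrite /is_matching sub1set eG trivIset1. Qed.

Lemma is_matching0 : is_matching (set0 : {set {set G}}).
Proof. by rewrite /is_matching sub0set /trivIset /cover !big_set0 cards0. Qed.

Lemma cover0 : cover (set0 : {set {set G}}) = set0.
Proof. by rewrite /cover big_set0. Qed.

Lemma coverS M N : M \subset N -> cover M \subset cover N.
Proof.
move=> sMN; apply/bigcupsP=> e eM; apply: bigcup_sup; exact: (subsetP sMN).
Qed.

Lemma is_matchingU1 e F :
  e \in edges G -> is_matching F -> [disjoint e & cover F] ->
  is_matching (e |: F).
Proof.
move=> eG matF deF; apply: is_matchingU => //; first exact: is_matching1.
by rewrite cover1.
Qed.

Lemma card_cover_matching M : is_matching M -> #|cover M| = #|M| * 2.
Proof.
case/andP=> ME triv; have /eqP-> : #|cover M| == \sum_(e in M) #|e|.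
  by rewrite (leq_card_cover M).2.
rewrite -sum_nat_const; apply: eq_bigr => e eM.
by apply: card_edge; apply: (subsetP ME).
Qed.

(* Repeatedly match a vertex outside A to one inside A while there is one,
   and then any two vertices of A. *)
Lemma dominating_perfect_matching A W :
  ~~ odd #|W| -> #|W :\: A| * 2 <= #|W| ->
  {in A :&: W & W, forall x y, x != y -> sedge x y} ->
  exists2 F, is_matching F & cover F = W.
Proof.
move: {2}#|W| (leqnn #|W|) => m; elim: m W => [|m IHm] W.
  rewrite leqn0 cards_eq0 => /eqP-> _ _ _.
  by exists set0; [exact: is_matching0 | exact: cover0].
move=> leW evW half adj.
have [->|W0] := eqVneq W set0.
  by exists set0; [exact: is_matching0 | exact: cover0].
have cW := cardsID A W.
have Wpos : 0 < #|W| by rewrite card_gt0.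
have [x /setIP[xW xA]] : exists x, x \in W :&: A.
  by apply/set0Pn; rewrite -card_gt0; lia.
(* Each round removes two vertices of [W], so keeping [W :\: A] at most half of [W] requires it to
   lose one vertex as long as it is nonempty. Once it is empty, the predecessor of 0 is 0, and a
   second vertex exists because [#|W|] is even. *)
have [y [yW yx decr]] : exists y, [/\ y \in W, x != y &
    #|W :\: A :\: [set x; y]| = #|W :\: A|.-1].
  have [WA0|/set0Pn[y yWA]] := eqVneq (W :\: A) set0.
    have [y /setD1P[yx yW]] : exists y, y \in W :\ x.
      apply/set0Pn; rewrite -card_gt0.
      by move: evW; rewrite (cardsD1 x W) xW; case: #|_|.
    exists y; split=> //; first by rewrite eq_sym.
    by rewrite WA0 set0D cards0.
  exists y; move: (yWA) => /setDP[yW yA]; split=> //.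
    by apply: contraNneq yA => <-.
  rewrite (cardsD1 y (W :\: A)) yWA add1n /=; apply: eq_card => z.
  rewrite !inE; case: (z =P x) => [->|_]; last by rewrite orFb.
  by rewrite xA !andbF.
have eG : [set x; y] \in edges G.
  by apply/edgesP; exists x, y; split=> //; apply: adj; rewrite // inE xA.
have eW : [set x; y] \subset W by rewrite subUset !sub1set xW.
have cWe : #|W :\: [set x; y]| = #|W| - 2 by rewrite cardsDS // (card_edge eG).
have cWe2 : 2 <= #|W| by rewrite -(card_edge eG); apply: subset_leq_card.
have [||||F matF covF] := IHm (W :\: [set x; y]).
- by lia.
- by rewrite cWe; lia.
- rewrite setDDl setUC -setDDl decr; lia.
- move=> u w; rewrite !inE => /andP[uA /andP[_ uW]] /andP[_ wW].
  by apply: adj; rewrite // inE uA.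
exists ([set x; y] |: F).
  apply: is_matchingU1 => //; rewrite covF -setI_eq0.
  by apply/eqP/setP=> z; rewrite !inE; case: (_ || _).
rewrite cover_setU cover1 covF; apply/setP=> z; rewrite !inE.
by have := subsetP eW z; rewrite !inE; case: (_ || _) => // ->.
Qed.

(* Extendability of the subgraph of G induced on X, expressed with vertex sets
   and matchings of G itself: nested deletions need no change of carrier. *)
Definition extendable_in n k X : Prop :=
  [/\ n + 2 * k + 2 <= #|X|, ~~ odd (#|X| - n)
    & forall T, T \subset X -> #|T| = n ->
      (exists M, is_kmatching k M /\ cover M \subset X :\: T) /\
      (forall M, is_kmatching k M -> cover M \subset X :\: T ->
       exists F, [/\ is_matching F, cover F = X :\: T & M \subset F])].

End Matchings.

(** * Transport of matchings and extendability along embeddings *)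

Section Embedding.
Variables (H G : sgraph) (f : H -> G).

(** Non-edges are preserved too, so [f] identifies [H] with the subgraph of [G] induced on its
    image. *)
Definition embedding := injective f /\ forall x y, sedge (f x) (f y) = sedge x y.

Hypothesis f_emb : embedding.
Let f_inj : injective f := f_emb.1.

Definition push (M : {set {set H}}) : {set {set G}} := [set f @: (B : {set H}) | B in M].

Lemma mem_push M (B : {set H}) : (f @: B \in push M) = (B \in M).
Proof. by rewrite /push (mem_imset _ _ (imset_inj f_inj)). Qed.

Lemma push_sub M N : (push M \subset push N) = (M \subset N).
Proof.
apply/idP/idP => [/subsetP s|]; last exact: imsetS.
by apply/subsetP=> B; rewrite -!mem_push; apply: s.
Qed.

Lemma cover_push M : cover (push M) = f @: cover M.
Proof. by rewrite cover_imset imset_cover. Qed.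

Lemma card_push M : #|push M| = #|M|.
Proof. by rewrite card_imset //; apply: imset_inj. Qed.

Lemma push_edge (e : {set H}) : (f @: e \in edges G) = (e \in edges H).
Proof.
apply/edgesP/edgesP => [[u [w [uw fe]]]|[x [y [xy ->]]]].
  have /imsetP[x xe ux] : u \in f @: e by rewrite fe set21.
  have /imsetP[y ye wy] : w \in f @: e by rewrite fe set22.
  exists x, y; rewrite -f_emb.2 -ux -wy; split=> //.
  by apply: (imset_inj f_inj); rewrite fe imsetU1 imset_set1 ux wy.
by exists (f x), (f y); rewrite f_emb.2 imsetU1 imset_set1.
Qed.

Lemma push_matching M : is_matching (push M) = is_matching M.
Proof.
rewrite /is_matching imset_trivIset //; congr (_ && _).
apply/subsetP/subsetP=> s e; first by rewrite -mem_push -push_edge; apply: s.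
by case/imsetP=> B BM ->; rewrite push_edge; apply: s.
Qed.

Lemma push_kmatching k M : is_kmatching k (push M) = is_kmatching k M.
Proof. by rewrite /is_kmatching push_matching card_push. Qed.

(** Taking preimages blockwise inverts [push], as every block of [N] lies in the image of [f]. This
    lets matchings of [G] be pulled back to [H]. *)
Lemma push_surj (N : {set {set G}}) :
  cover N \subset f @: [set: H] -> exists M, N = push M.
Proof.
move=> sN; exists [set f @^-1: (B : {set G}) | B in N].
rewrite /push -imset_comp -[LHS]imset_id; apply: eq_in_imset => B BN /=.
rewrite preimsetK //; apply: subset_trans sN; exact: bigcup_sup BN.
Qed.

End Embedding.

Lemma val_embedding (G : sgraph) (A : {set G}) :
  embedding (val : induced A -> G).
Proof. by split=> //; apply: val_inj. Qed.

Lemma val_induced (G : sgraph) (A : {set G}) :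
  (val : induced A -> G) @: [set: induced A] = A.
Proof.
apply/setP=> x; apply/imsetP/idP => [[y _ ->]|xA]; first exact: (valP y).
by exists (Sub x xA).
Qed.

Lemma embedding_comp (G1 G2 G3 : sgraph) (f : G1 -> G2) (g : G2 -> G3) :
  embedding f -> embedding g -> embedding (g \o f).
Proof.
move=> [f_inj fE] [g_inj gE]; split; first exact: inj_comp.
by move=> x y; rewrite /= gE fE.
Qed.

(** The composite [g] of [val] and [f] embeds [delete S] in [G] with image [X :\: f @: S]. Hence
    [push] is a bijection from the matchings of [delete S] onto the matchings of [G] covered by that
    image; it respects size and inclusion, and it turns 1-factors into matchings covering the whole
    image. *)
Lemma extendable_embedding (H G : sgraph) (f : H -> G) n k :
  embedding f -> extendable n k H <-> extendable_in n k (f @: [set: H]).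
Proof.
move=> f_emb; have f_inj := f_emb.1.
set X := f @: _; have cX : #|X| = #|H| by rewrite card_imset // cardsT.
rewrite /extendable /extendable_in cX.
pose g (S : {set H}) (x : delete S) := f (val x).
have g_emb S : embedding (@g S).
  exact: embedding_comp (val_embedding (~: S)) f_emb.
have g_img S : (@g S) @: [set: delete S] = X :\: f @: S.
  by rewrite /g imset_comp val_induced imsetC_inj.
have push_1factor S F : is_1factor F =
    is_matching (push (@g S) F) && (cover (push (@g S) F) == X :\: f @: S).
  rewrite /is_1factor push_matching // cover_push -g_img.
  by rewrite (inj_eq (imset_inj (g_emb S).1)).
split=> -[size_ok even_ok ext]; split=> //.
  move=> T TX cT.
  have [S TS] : exists S : {set H}, T = f @: S.
    by exists (f @^-1: T); rewrite preimsetK.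
  rewrite TS card_imset // in cT; have [[M matM] extM] := ext S cT.
  rewrite TS; split.
    exists (push (@g S) M); rewrite push_kmatching //; split=> //.
    by rewrite cover_push -g_img imsetS // subsetT.
  move=> N matN; rewrite -g_img => covN; have [M' defN] := push_surj covN.
  move: matN; rewrite defN push_kmatching // => /extM[F [fF MF]].
  exists (push (@g S) F); rewrite push_sub //; split=> //.
    by move: fF; rewrite push_1factor => /andP[].
  by rewrite g_img; move: fF; rewrite push_1factor => /andP[_ /eqP].
move=> S cS; have [|| [N [matN covN]] extN] := ext (f @: S).
- by rewrite imsetS ?subsetT.
- by rewrite card_imset.
split.
  move: covN; rewrite -g_img => /push_surj[M defN]; exists M.
  by rewrite -(push_kmatching (g_emb S)) -defN.
move=> M; rewrite -(push_kmatching (g_emb S)) => /extN[].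
  by rewrite cover_push -g_img imsetS ?subsetT.
move=> F [matF covF MF].
have [|F' defF] := @push_surj _ _ (@g S) F; first by rewrite covF g_img.
exists F'; rewrite push_1factor -defF matF covF eqxx; split=> //.
by rewrite -(push_sub (g_emb S)) -defF.
Qed.

Lemma extendable_inT (G : sgraph) n k : extendable n k G <-> extendable_in n k [set: G].
Proof.
have id_emb : embedding (id : G -> G) by split.
by rewrite -[X in extendable_in _ _ X]imset_id; apply: extendable_embedding.
Qed.

Lemma extendable_delete (G : sgraph) (e : {set G}) n k :
  extendable n k (delete e) <-> extendable_in n k (~: e).
Proof.
have := extendable_embedding n k (val_embedding (~: e)).
by rewrite val_induced.
Qed.

(** * From all the graphs G - V(e) to G *)

Lemma delete_edges_extendable (G : sgraph) n k :
  edges G != set0 ->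
  (forall e : {set G}, e \in edges G -> extendable n k (delete e)) ->
  extendable n (k + 1) G.
Proof.
(* The edge [e0] supplies the size and parity conditions; in an edgeless graph the assumption would
   be vacuous. *)
case/set0Pn=> e0 e0G ext.
have {}ext e : e \in edges G -> extendable_in n k (~: e).
  by move=> eG; apply/extendable_delete/ext.
have cC e : e \in edges G -> #|~: e| + 2 = #|G|.
  by move=> eG; rewrite -(cardsC e) (card_edge eG) addnC.
have [size_ok even_ok ext0] := ext e0 e0G; have c0 := cC e0 e0G.
apply/extendable_inT; split; rewrite ?cardsT -?c0; first by lia.
  have -> : #|~: e0| + 2 - n = #|~: e0| - n + 2 by lia.
  by rewrite oddD addbF.
move=> T _ cT; rewrite setTD.
have extend M : is_kmatching (k + 1) M -> cover M \subset ~: T ->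
    exists F, [/\ is_matching F, cover F = ~: T & M \subset F].
  case/andP=> matM /eqP cM covM.
  have /set0Pn[e eM] : M != set0 by rewrite -card_gt0 cM addn1.
  have [/subsetP MG triv] := andP matM; have eG := MG e eM.
  have covMe : cover (M :\ e) = cover M :\: e by rewrite coverD1.
  (* [M] avoids [T] and contains [e], so [T] is an admissible deleted set in G - V(e). *)
  have TC : T \subset ~: e.
    by rewrite subsetC; apply: subset_trans covM; apply: bigcup_sup eM.
  have [_ _ /(_ T TC cT)[_ extM]] := ext e eG.
  have [||F [matF covF MF]] := extM (M :\ e).
  - apply/andP; split; first exact: is_matchingS (subsetDl _ _) matM.
    by move: cM; rewrite (cardsD1 e) eM; lia.
  - rewrite covMe; apply/subsetP=> x; rewrite !inE => /andP[-> xM].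
    by have := subsetP covM x xM; rewrite inE => ->.
  exists (e |: F); split; last by rewrite -(setD1K eM) setUS.
    apply: is_matchingU1; rewrite // covF -setI_eq0.
    by apply/eqP/setP=> z; rewrite !inE; case: (z \in e); rewrite ?andbF.
  rewrite cover_setU cover1 covF; apply/setP=> z; rewrite !inE.
  by have := subsetP TC z; rewrite !inE; case: (z \in e); case: (z \in T) => //= ->.
split=> //.
(* For the existence of a (k+1)-matching, [T] may meet [e0]. Its vertices in [e0] are exchanged for
   vertices outside both sets, giving [T']; a 1-factor of G - V(e0) - T' still avoids all of [T]. *)
have [T' [T'C cT' sT']] : exists T' : {set G},
    [/\ T' \subset ~: e0, #|T'| = n & T :\: e0 \subset T'].
  have [B BC cB] : exists2 B : {set G}, B \subset ~: e0 :\: T & #|B| = #|T :&: e0|.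
    apply: exists_subset_card.
    have := cardsID T (~: e0); have := cardsID e0 T; rewrite setDE (setIC T (~: e0)); lia.
  exists (B :|: (T :\: e0)); split; last exact: subsetUr.
    rewrite subUset; apply/andP; split.
      exact: subset_trans BC (subsetDl _ _).
    by apply/subsetP=> z; rewrite !inE => /andP[].
  rewrite cardsU cB -cT -(cardsID e0 T).
  suff -> : B :&: (T :\: e0) = set0 by rewrite cards0 subn0.
  apply/setP=> z; rewrite !inE; have := subsetP BC z; rewrite !inE.
  by case: (z \in B) => //= /(_ isT) /andP[/negPf->]; rewrite andbF.
have [[M [/andP[matM /eqP cM] covM]] extM] := ext0 T' T'C cT'.
have [F [matF covF _]] := extM M (introT andP (conj matM (introT eqP cM))) covM.
(* The summand 2 in [size_ok] is what counts: at least [2 * k + 2] vertices remain to be covered. *)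
have kF : k + 1 <= #|F|.
  have := card_cover_matching matF; rewrite covF cardsDS // cT'; lia.
have [N NF cN] := exists_subset_card kF.
exists N; split.
  by rewrite /is_kmatching cN eqxx andbT; apply: is_matchingS matF.
apply: subset_trans (coverS NF) _; rewrite covF.
apply/subsetP=> z; rewrite !inE => /andP[zT' ze]; apply: contra zT' => zT.
by apply: (subsetP sT'); rewrite inE ze.
Qed.

(** * The graph witnessing both non-implications *)

Section Hub.
Variables s a : nat.

(** [None] is the apex, ['I_s] indexes the rim and ['I_a] the core. *)
Definition hub_vertex : finType := option ('I_s + 'I_a).

Definition hub_rel : rel hub_vertex := fun x y =>
  match x, y with
  | None, Some (inl _) | Some (inl _), None => true
  | Some (inl _), Some (inr _) | Some (inr _), Some (inl _) => true
  | Some (inr i), Some (inr j) => i != j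
  | _, _ => false
  end.

Lemma hub_sym : symmetric hub_rel.
Proof. by case=> [[i|i]|] [[j|j]|] //=; rewrite eq_sym. Qed.

Lemma hub_irrefl : irreflexive hub_rel.
Proof. by case=> [[i|i]|] //=; rewrite eqxx. Qed.

Definition hub : sgraph := SGraph hub_sym hub_irrefl.

Definition rim : {set hub} := [set Some (inl i) | i : 'I_s].
Definition core : {set hub} := [set Some (inr i) | i : 'I_a].
Definition apex : hub := None.

Lemma card_hub : #|hub| = s + a + 1.
Proof. by rewrite card_option card_sum !card_ord addn1. Qed.

Lemma card_rim : #|rim| = s.
Proof. by rewrite card_imset ?card_ord // => x y []. Qed.

Lemma card_core : #|core| = a.
Proof. by rewrite card_imset ?card_ord // => x y []. Qed.

Lemma hubP x : [|| x == apex, x \in rim | x \in core].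
Proof.
case: x => [[i|i]|] //=; last by rewrite imset_f ?orbT.
by rewrite imset_f ?orbT.
Qed.

Lemma inl_rim i : (Some (inl i) : hub) \in rim.
Proof. exact: imset_f. Qed.

Lemma core_rim x : x \in core -> x \notin rim.
Proof. by case/imsetP=> i _ ->; apply/negP; case/imsetP. Qed.

Lemma apex_rim : apex \notin rim.
Proof. by apply/negP; case/imsetP. Qed.

Lemma apex_core : apex \notin core.
Proof. by apply/negP; case/imsetP. Qed.

Lemma sedge_apex x : sedge apex x = (x \in rim).
Proof.
case: x => [[i|i]|] /=; first by rewrite inl_rim.
  by symmetry; apply/negbTE/negP; case/imsetP.
by rewrite (negbTE apex_rim).
Qed.

Lemma sedge_core x y : x \in core -> y != apex -> x != y -> sedge x y.
Proof. by case/imsetP=> i _ ->; case: y => [[j|j]|]. Qed.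

Lemma sedge_rim x y : x \in rim -> y \in rim -> sedge x y = false.
Proof. by case/imsetP=> i _ -> /imsetP[j _ ->]. Qed.

Lemma rim_edge e x y :
  e \in edges hub -> x \in e -> y \in e -> x \in rim -> y \in rim -> x = y.
Proof.
case/edgesP=> u [w [uw ->]] /set2P[]-> /set2P[]-> // xr yr; move: uw.
  by rewrite sedge_rim.
by rewrite sedge_sym sedge_rim.
Qed.

Lemma card_rim_cover M : is_matching M -> #|rim :&: cover M| <= #|M|.
Proof.
case/andP=> /subsetP ME triv.
rewrite -(card_in_imset (f := pblock M)).
  apply/subset_leq_card/subsetP=> e /imsetP[x /setIP[_ xM] ->].
  exact: pblock_mem.
move=> x y /setIP[xr xM] /setIP[yr yM] exy.
apply: (@rim_edge (pblock M x)) => //; first exact/ME/pblock_mem.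
  by rewrite mem_pblock.
by rewrite exy mem_pblock.
Qed.

Lemma hub_matching n k (T : {set hub}) M :
  n + k + 2 <= s -> n + 2 * k + 2 + s <= a -> ~~ odd (s + a + 1 - n) ->
  #|T| = n -> is_matching M -> #|M| <= k + 1 -> [disjoint T & cover M] ->
  exists2 F, is_matching F & cover F = ~: (T :|: cover M).
Proof.
move=> le_s le_a ev cT matM cM dTM; set W := ~: _.
have cTM : #|T :|: cover M| = n + #|M| * 2.
  by rewrite cardsU disjoint_setI0 // cards0 subn0 cT card_cover_matching.
have cW : #|W| + (n + #|M| * 2) = s + a + 1.
  by rewrite -cTM -card_hub -(cardsC W) setCK.
have evW : ~~ odd #|W|.
  have -> : #|W| = (s + a + 1 - n) - #|M| * 2 by lia.
  by rewrite oddB ?oddM ?andbF ?addbF //; lia.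
have [apexW|apexW] := boolP (apex \in W); last first.
  apply: (@dominating_perfect_matching _ core) => //.
    suff : #|W :\: core| <= s by lia.
    rewrite -card_rim; apply/subset_leq_card/subsetP=> x /setDP[xW xc].
    case/or3P: (hubP x) => // [/eqP xa|xc']; first by rewrite -xa xW in apexW.
    by rewrite xc' in xc.
  move=> x y /setIP[xc _] yW xy; apply: sedge_core => //.
  by apply: contraNneq apexW => <-.
have [r /setDP[r_rim rTM]] : exists r, r \in rim :\: (T :|: cover M).
  apply/set0Pn; rewrite -card_gt0.
  have := cardsID (T :|: cover M) rim; rewrite card_rim setIUr.
  have := card_rim_cover matM; have := subset_leq_card (subsetIr rim T).
  have := cardsUI (rim :&: T) (rim :&: cover M); lia.
have rW : r \in W by rewrite inE.
have eG : [set apex; r] \in edges hub.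
  by apply/edgesP; exists apex, r; rewrite sedge_apex.
have eW : [set apex; r] \subset W by rewrite subUset !sub1set apexW.
have cWe : #|W :\: [set apex; r]| = #|W| - 2 by rewrite cardsDS // (card_edge eG).
have [|||F matF covF] :=
    @dominating_perfect_matching _ core (W :\: [set apex; r]).
- by rewrite cWe oddB ?addbF // -(card_edge eG) subset_leq_card.
- suff : #|W :\: [set apex; r] :\: core| <= s by lia.
  rewrite -card_rim; apply/subset_leq_card/subsetP=> x.
  rewrite !inE => /andP[xc /andP[xa _]].
  by have := hubP x; rewrite (negbTE xc) orbF; case: eqP xa.
- move=> x y /setIP[xc _] yW xy; apply: sedge_core => //.
  by apply: contraTneq yW => ->; rewrite !inE.
exists ([set apex; r] |: F).
  apply: is_matchingU1 => //; rewrite covF -setI_eq0.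
  by apply/eqP/setP=> z; rewrite !inE; case: (_ || _).
by rewrite cover_setU cover1 covF -{2}(setID W [set apex; r]) (setIidPr eW).
Qed.

Lemma hub_delete_extendable n k (e : {set hub}) :
  n + k + 2 <= s -> n + 2 * k + 2 + s <= a -> ~~ odd (s + a + 1 - n) ->
  e \in edges hub -> extendable n k (delete e).
Proof.
move=> le_s le_a ev eG; apply/extendable_delete.
have e2 := card_edge eG.
have ce : #|~: e| = s + a - 1 by have := cardsC e; rewrite card_hub e2; lia.
rewrite /extendable_in ce; split; first by lia.
  have -> : s + a - 1 - n = s + a + 1 - n - 2 by lia.
  by rewrite oddB ?addbF //; lia.
move=> T TC cT.
have ext M : is_matching M -> #|M| <= k -> cover M \subset ~: e :\: T ->
    exists F, [/\ is_matching F, cover F = ~: e :\: T & M \subset F].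
  move=> matM cM covM.
  have deM : [disjoint e & cover M].
    by rewrite disjoint_sym disjoints_subset (subset_trans covM) ?subsetDl.
  have dTM : [disjoint T & e :|: cover M].
    rewrite disjoint_sym disjoints_subset subUset subsetC TC /=.
    by apply: subset_trans covM _; rewrite setDE subsetIr.
  have [|||F matF covF] := @hub_matching n k T (e |: M) le_s le_a ev cT.
  - exact: is_matchingU1.
  - by rewrite cardsU1; case: (_ \notin _); lia.
  - by rewrite cover_setU cover1.
  move: covF; rewrite cover_setU cover1 => covF.
  exists (M :|: F); rewrite subsetUl; split=> //.
    apply: is_matchingU => //; rewrite covF disjoint_sym disjoints_subset.
    by rewrite setCS setUA subsetUr.
  rewrite cover_setU covF; apply/setP=> z; have := subsetP covM z.
  rewrite !inE; case: (z \in cover M) => /= [/(_ isT)//|_].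
  by rewrite orbF negb_or andbC.
split; last by move=> M /andP[matM /eqP cM]; apply: ext; rewrite ?cM.
have [|||F [matF covF _]] := ext set0.
- exact: is_matching0.
- by rewrite cards0.
- by rewrite cover0 sub0set.
have kF : k <= #|F|.
  have := card_cover_matching matF; rewrite covF cardsDS // cT ce; lia.
have [N NF cN] := exists_subset_card kF.
exists N; rewrite -covF (coverS NF) /is_kmatching cN eqxx andbT; split=> //.
exact: is_matchingS matF.
Qed.

Lemma hub_not_extendable t j :
  t + j = s -> j <= a -> ~ extendable t j hub.
Proof.
move=> tj ja /extendable_inT[_ _ ext].
have [T T_rim cT] : exists2 T : {set hub}, T \subset rim & #|T| = t.
  by apply: exists_subset_card; rewrite card_rim; lia.
have [B B_core cB] : exists2 B : {set hub}, B \subset core & #|B| = j.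
  by apply: exists_subset_card; rewrite card_core.
have cD : #|rim :\: T| = j by rewrite cardsDS // card_rim cT; lia.
pose W := (rim :\: T) :|: B.
have WB : W :\: core = rim :\: T.
  apply/setP=> x; rewrite !inE; have := @core_rim x; have := subsetP B_core x.
  case: (x \in core) => /= [_ /(_ isT)/negbTE->|]; rewrite ?andbF //.
  by case: (x \in B) => [/(_ isT)//|]; rewrite ?orbF.
have cW : #|W| = j * 2.
  rewrite -(cardsID core W) WB cD; suff -> : W :&: core = B by rewrite cB; lia.
  apply/setP=> x; rewrite !inE; have := @core_rim x; have := subsetP B_core x.
  case: (x \in core) => /= [_ /(_ isT)/negbTE->|]; rewrite ?andbF ?andbT //.
  by case: (x \in B) => [/(_ isT)//|].
have apexW : apex \notin W.
  rewrite !inE (negbTE apex_rim) andbF /=.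
  by apply: contra apex_core; apply: (subsetP B_core).
have [|||M matM covM] := @dominating_perfect_matching _ core W.
- by rewrite cW oddM andbF.
- by rewrite WB cD cW.
- move=> x y /setIP[xc _] yW xy; apply: sedge_core => //.
  by apply: contraNneq apexW => <-.
have cM : #|M| = j by have := card_cover_matching matM; rewrite covM cW; lia.
have [_ /(_ M)] := ext T (subsetT T) cT.
case=> [||F [/andP[/subsetP FE triv] covF MF]].
- by rewrite /is_kmatching matM cM eqxx.
- rewrite covM setTD subsetC; apply/subsetP=> x xT; rewrite !inE xT /=.
  by apply/negP => /(subsetP B_core)/core_rim; rewrite (subsetP T_rim).
have apexF : apex \in cover F.
  by rewrite covF !inE andbT (contra _ apex_rim) //; apply: (subsetP T_rim).
have eF := pblock_mem apexF; set e := pblock F apex in eF.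
have ae : apex \in e by rewrite mem_pblock.
have [r [re r_rim]] : exists r, r \in e /\ r \in rim.
  have /edgesP[x [y [xy def_e]]] := FE e eF; rewrite def_e.
  move: ae; rewrite def_e => /set2P[ax|ay].
    by exists y; rewrite set22 -sedge_apex ax.
  by exists x; rewrite set21 -sedge_apex ay sedge_sym.
have rT : r \notin T.
  have : r \in cover F by apply/bigcupP; exists e.
  by rewrite covF !inE andbT.
have /bigcupP[e' e'M re'] : r \in cover M by rewrite covM !inE rT r_rim.
have ee' : e = e'.
  by rewrite -(def_pblock triv eF re) (def_pblock triv _ re') // (subsetP MF).
by move: apexW; rewrite -covM => /bigcupP; case; exists e; rewrite // ee'.
Qed.

Lemma hub_edges : 0 < s -> edges hub != set0.
Proof.
move=> s_gt0; have [r r_rim] : exists r, r \in rim.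
  by apply/set0Pn; rewrite -card_gt0 card_rim.
by apply/set0Pn; exists [set apex; r]; apply/edgesP; exists apex, r; rewrite sedge_apex.
Qed.

End Hub.

Theorem theorem2 (n k : nat) :
  (forall G : sgraph,
     edges G != set0 ->
     (forall e : {set G}, e \in edges G -> extendable n k (delete e)) ->
     extendable n (k + 1) G) /\
  (exists G : sgraph,
     edges G != set0 /\
     (forall e : {set G}, e \in edges G -> extendable n k (delete e)) /\
     ~ extendable n (k + 2) G) /\
  (exists G : sgraph,
     edges G != set0 /\
     (forall e : {set G}, e \in edges G -> extendable n k (delete e)) /\
     ~ extendable (n + 2) k G).
Proof.
split; first by move=> G; apply: delete_edges_extendable.
pose s := n + k + 2; pose a := 2 * n + 3 * k + 5; pose G := hub s a.
have G_edges : edges G != set0 by apply: hub_edges; lia.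
have G_ext (e : {set G}) : e \in edges G -> extendable n k (delete e).
  by apply: hub_delete_extendable; lia.
by split; exists G; split=> //; split=> //; apply: hub_not_extendable; lia.
Qed.
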